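(* Let $R$ be a commutative ring with identity, let $M_1, M_2, N$ be $R$-modules, and let $f_j : M_j \to N$ ($j=1,2$) be $R$-linear maps. Then $$\ker(f_1\mid f_2) = \operatorname{coker}\bigl[\ker(f_1)\hookrightarrow \ker(f_1,f_2)\bigr].$$
   Context: For $R$-linear maps $f_1:M_1\to N$ and $f_2:M_2\to N$, define $\ker(f_1\mid f_2)=\{m_2\in M_2 \mid \exists m_1\in M_1 : f_1(m_1)+f_2(m_2)=0\}$, an $R$-submodule of $M_2$, and $\ker(f_1,f_2)=\{(m_1,m_2)\in M_1\oplus M_2 \mid f_1(m_1)+f_2(m_2)=0\}$, the kernel of the map $M_1\oplus M_2\to N$, $(m_1,m_2)\mapsto f_1(m_1)+f_2(m_2)$. The module $\ker(f_1)$ is regarded as a submodule of $\ker(f_1,f_2)$ via $m_1\mapsto(m_1,0)$. *)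

(* Defs.v *)
From HB Require Import structures.
From mathcomp Require Import all_boot all_algebra.
From mathcomp Require Import boolp.

Set Implicit Arguments.
Unset Strict Implicit.
Unset Printing Implicit Defensive.

Import GRing.Theory.
Local Open Scope ring_scope.
Local Open Scope quotient_scope.

(* A submodule is a boolean predicate closed under the module operations;      *)
(* predicates involving an existential are made boolean by `[< _ >]. The type  *)
(* [submodule S] is the same submodule as an R-module in its own right.        *)
Section Submodule.
Variables (R : comPzRingType) (V : lmodType R) (S : submodClosed V).

Record submodule :=
  Submodule { submodule_val : V; _ : submodule_val \in (S : {pred V}) }.

HB.instance Definition _ := [isSub for submodule_val].
HB.instance Definition _ := [Choice of submodule by <:].
HB.instance Definition _ := [SubChoice_isSubLmodule of submodule by <:].
End Submodule.

Section Kernel.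
Variables (R : comPzRingType) (U V : lmodType R) (f : {linear U -> V}).

Definition ker_pred : {pred U} := [pred u | f u == 0].

Fact ker_submod_closed : submod_closed ker_pred.
Proof.
split=> [|a u v]; rewrite !inE ?linear0 // => /eqP fu /eqP fv.
by rewrite linearP fu fv scaler0 addr0.
Qed.

HB.instance Definition _ :=
  GRing.isSubmodClosed.Build R U ker_pred ker_submod_closed.

Definition ker := submodule ker_pred.

HB.instance Definition _ := GRing.SubLmodule.on ker.
End Kernel.

Section Cokernel.
Variables (R : comPzRingType) (U V : lmodType R) (f : {linear U -> V}).

Definition im_pred : {pred V} := [pred v | `[< exists u, f u = v >]].

Fact im_submod_closed : submod_closed im_pred.
Proof.
split=> [|a v w]; rewrite !inE; first by apply/asboolP; exists 0; rewrite linear0.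
move=> /asboolP[u <-] /asboolP[t <-]; apply/asboolP.
by exists (a *: u + t); rewrite linearP.
Qed.

HB.instance Definition _ :=
  GRing.isSubmodClosed.Build R V im_pred im_submod_closed.

Definition coker := Quotient.quot im_pred.

HB.instance Definition _ := ZmodQuotient.on coker.

Lemma pi_coker_add : {morph \pi_coker : x y / x + y}.
Proof. exact: pi_addr. Qed.

Definition coker_scale (a : R) : coker -> coker :=
  lift_op1 coker ( *:%R a).

Lemma pi_coker_scale a : {morph \pi_coker : x / a *: x >-> coker_scale a x}.
Proof.
move=> x; unlock coker_scale; apply/eqP.
rewrite -[_ == _]Quotient.idealrBE -scalerBr rpredZ // Quotient.idealrBE.
by rewrite reprK.
Qed.

Fact coker_scaleA a b x :
  coker_scale a (coker_scale b x) = coker_scale (a * b) x.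
Proof. by rewrite -[x]reprK -!pi_coker_scale scalerA. Qed.

Fact coker_scale1 : left_id 1 coker_scale.
Proof. by move=> x; rewrite -[x]reprK -pi_coker_scale scale1r. Qed.

Fact coker_scaleDr : right_distributive coker_scale +%R.
Proof.
move=> a x y; rewrite -[x]reprK -[y]reprK.
by rewrite -pi_coker_add -!pi_coker_scale -pi_coker_add scalerDr.
Qed.

Fact coker_scaleDl x : {morph coker_scale^~ x : a b / a + b}.
Proof.
move=> a b; rewrite -[x]reprK.
by rewrite -!pi_coker_scale -pi_coker_add scalerDl.
Qed.

HB.instance Definition _ := GRing.Zmodule_isLmodule.Build R coker
  coker_scaleA coker_scale1 coker_scaleDr coker_scaleDl.

Fact pi_coker_linear : linear \pi_coker.
Proof. by move=> a x y; rewrite pi_coker_add pi_coker_scale. Qed.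

HB.instance Definition _ :=
  GRing.isLinear.Build R V coker *:%R \pi_coker pi_coker_linear.
End Cokernel.

(* Notation: [ker_pair] is ker(f1, f2) and [ker_bar] is ker(f1 | f2). *)
Section KernelsOfPair.
Variables (R : comPzRingType) (M1 M2 N : lmodType R).
Variables (f1 : {linear M1 -> N}) (f2 : {linear M2 -> N}).

Definition sum_map (m : M1 * M2) : N := f1 m.1 + f2 m.2.

Fact sum_map_linear : linear sum_map.
Proof.
by move=> a x y; rewrite /sum_map !linearP scalerDr addrACA.
Qed.

HB.instance Definition _ :=
  GRing.isLinear.Build R (M1 * M2)%type N *:%R sum_map sum_map_linear.

Definition ker_pair := ker sum_map.

HB.instance Definition _ := GRing.SubLmodule.on ker_pair.

Definition ker_bar_pred : {pred M2} :=
  [pred m2 | `[< exists m1 : M1, f1 m1 + f2 m2 = 0 >]].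

Fact ker_bar_submod_closed : submod_closed ker_bar_pred.
Proof.
split=> [|a x y]; rewrite !inE.
  by apply/asboolP; exists 0; rewrite !raddf0 addr0.
move=> /asboolP[u xu] /asboolP[v yv]; apply/asboolP; exists (a *: u + v).
by rewrite !linearP addrACA -scalerDr xu yv scaler0 addr0.
Qed.

HB.instance Definition _ :=
  GRing.isSubmodClosed.Build R M2 ker_bar_pred ker_bar_submod_closed.

Definition ker_bar := submodule ker_bar_pred.

HB.instance Definition _ := GRing.SubLmodule.on ker_bar.

Fact ker_incl_subproof (m1 : ker f1) : (val m1, 0) \in ker_pred sum_map.
Proof.
by case: m1 => m1 /= /eqP fm1; rewrite inE /= /sum_map /= fm1 raddf0 addr0.
Qed.

Definition ker_incl (m1 : ker f1) : ker_pair :=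
  Submodule (ker_incl_subproof m1).

Fact ker_incl_linear : linear ker_incl.
Proof.
by move=> a x y; apply: val_inj; congr (_, _); rewrite /= scaler0 addr0.
Qed.

HB.instance Definition _ :=
  GRing.isLinear.Build R (ker f1) ker_pair *:%R ker_incl ker_incl_linear.

Fact ker_incl_inj : injective ker_incl.
Proof. by move=> x y /(congr1 val) [] /val_inj. Qed.
End KernelsOfPair.

Arguments ker_incl {R M1 M2 N} f1 f2 m1.

(* Main.v *)
Require Import Defs.
From HB Require Import structures.
From mathcomp Require Import all_boot all_algebra.
From mathcomp Require Import boolp.

Set Implicit Arguments.
Unset Strict Implicit.
Unset Printing Implicit Defensive.

Import GRing.Theory.
Local Open Scope ring_scope.
Local Open Scope quotient_scope.

(** The second projection maps [ker_pair f1 f2] onto [ker_bar f1 f2]: a member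
    [m2] of the latter comes with some [m1] such that [f1 m1 + f2 m2 = 0], that
    is, with a preimage [(m1, m2)].  A pair is killed by this projection exactly
    when it has the form [(m1, 0)] with [f1 m1 = 0], which is exactly when it
    lies in the image of [ker_incl f1 f2].  So
      [0 -> ker f1 -> ker_pair f1 f2 -> ker_bar f1 f2 -> 0]
    is exact ([ker_bar_proj_exact], [ker_bar_proj_surj]), and the theorem is the
    first isomorphism theorem ([coker_iso]): a surjection [g] whose kernel is the
    image of [f] induces an isomorphism from the cokernel of [f]. *)

Section CokernelDescent.
Variables (R : comPzRingType) (U V W : lmodType R).
Variables (f : {linear U -> V}) (g : {linear V -> W}).

Lemma pi_coker_eqP (x y : V) :
  reflect (exists u, f u = x - y) (\pi_(coker f) x == \pi_(coker f) y).
Proof.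
by rewrite -[_ == _]Quotient.idealrBE; apply: (iffP (asboolP _)).
Qed.

(** The proof of [g \o f = 0] is an argument so that linearity, which fails
    without it, can be declared as a canonical instance. *)
Definition coker_desc of (forall u, g (f u) = 0) :=
  fun x : coker f => g (repr x).

Hypothesis gf0 : forall u, g (f u) = 0.

Lemma coker_desc_pi v : coker_desc gf0 (\pi v) = g v.
Proof.
apply/eqP; rewrite -subr_eq0 -raddfB /=.
have /pi_coker_eqP[u <-] : \pi_(coker f) (repr (\pi_(coker f) v)) == \pi v.
  by rewrite reprK.
by rewrite gf0.
Qed.

Fact coker_desc_linear : linear (coker_desc gf0).
Proof.
move=> a x y; rewrite -[x]reprK -[y]reprK.
by rewrite -linearP !coker_desc_pi linearP.
Qed.

HB.instance Definition _ :=
  GRing.isLinear.Build R (coker f) W *:%R (coker_desc gf0) coker_desc_linear.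

End CokernelDescent.

(** First isomorphism theorem: exactness at [V] makes the map induced by [g]
    well defined and injective, and exactness at [W] makes it surjective. *)
Lemma coker_iso (R : comPzRingType) (U V W : lmodType R)
    (f : {linear U -> V}) (g : {linear V -> W}) :
    (forall v, g v = 0 <-> exists u, f u = v) ->
    (forall w, exists v, g v = w) ->
  exists phi : {linear coker f -> W},
    bijective phi /\ forall v, phi (\pi_(coker f) v) = g v.
Proof.
move=> exact_g surj_g.
have gf0 u : g (f u) = 0 by apply/exact_g; exists u.
have [s sK] := choice surj_g.
exists (coker_desc gf0); split; last exact: coker_desc_pi.
exists (fun w => \pi_(coker f) (s w)) => [x|w]; last by rewrite /= coker_desc_pi.
rewrite -[x in RHS]reprK; apply/eqP/pi_coker_eqP/exact_g.
by rewrite linearB /= sK subrr.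
Qed.

Section KernelBarProjection.
Variables (R : comPzRingType) (M1 M2 N : lmodType R).
Variables (f1 : {linear M1 -> N}) (f2 : {linear M2 -> N}).

Fact ker_bar_proj_subproof (m : ker_pair f1 f2) :
  (val m).2 \in ker_bar_pred f1 f2.
Proof. by apply/asboolP; exists (val m).1; apply/eqP; exact: (valP m). Qed.

Definition ker_bar_proj (m : ker_pair f1 f2) : ker_bar f1 f2 :=
  Submodule (ker_bar_proj_subproof m).

Fact ker_bar_proj_linear : linear ker_bar_proj.
Proof. by move=> a x y; apply: val_inj. Qed.

HB.instance Definition _ :=
  GRing.isLinear.Build R (ker_pair f1 f2) (ker_bar f1 f2) *:%R
    ker_bar_proj ker_bar_proj_linear.

(** If [m2 = 0], the equation [f1 m1 + f2 m2 = 0] says that [m1] is in the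
    kernel of [f1]. *)
Lemma ker_bar_proj_exact (m : ker_pair f1 f2) :
  ker_bar_proj m = 0 <-> exists k, ker_incl f1 f2 k = m.
Proof.
split=> [/(congr1 val) /= m2_0|[k <-]]; last exact: val_inj.
have k_ker : (val m).1 \in ker_pred f1.
  by have := valP m; rewrite !inE /= /sum_map m2_0 raddf0 addr0.
exists (Submodule k_ker); apply: val_inj => /=.
by rewrite -[0 in LHS]m2_0 -surjective_pairing.
Qed.

Lemma ker_bar_proj_surj (w : ker_bar f1 f2) : exists m, ker_bar_proj m = w.
Proof.
have /asboolP[m1 /eqP m_ker] := valP w.
have m_in : (m1, val w) \in ker_pred (sum_map f1 f2) by [].
by exists (Submodule m_in); apply: val_inj.
Qed.

End KernelBarProjection.

Theorem theorem2p4 (R : comPzRingType) (M1 M2 N : lmodType R)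
    (f1 : {linear M1 -> N}) (f2 : {linear M2 -> N}) :
  exists phi : {linear coker (ker_incl f1 f2) -> ker_bar f1 f2},
    bijective phi /\
    forall m : ker_pair f1 f2,
      val (phi (\pi_(coker (ker_incl f1 f2)) m)) = (val m).2.
Proof.
have [phi [phi_bij phiE]] :=
  coker_iso (@ker_bar_proj_exact _ _ _ _ f1 f2) (@ker_bar_proj_surj _ _ _ _ f1 f2).
by exists phi; split=> // m; rewrite phiE.
Qed.
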